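(* Let $G$ be a Hausdorff topological group and let $\mathcal B=\{s\subseteq\omega: s\neq\emptyset,\ s\text{ finite},\ |s|=\min s+1\}$ be the Schreier barrier. If $G$ is $\mathcal B$-cascade countably compact, then $G^\omega$ is countably compact.
   Context: For $a,b\subseteq\omega$, $a\sqsubseteq b$ means $a$ is an initial segment of $b$. A front on an infinite set $M\subseteq\omega$ is a family $\mathcal B\subseteq[M]^{<\omega}$ of finite subsets of $M$ that is a $\sqsubseteq$-antichain and such that every infinite $N\subseteq M$ has an initial segment $s\sqsubseteq N$ with $s\in\mathcal B$. The Schreier barrier is a front on $\omega$. If $\mathcal B$ is a front on $M$ with $\emptyset\notin\mathcal B$ and $n\in M$, put $\mathcal B_{\{n\}}=\{t\setminus\{n\}:\{n\}\sqsubseteq t\in\mathcal B\}$; it is a front on $M\setminus(n+1)$. The recursion passing from $\mathcal B$ to the $\mathcal B_{\{n\}}$ is well-founded and ends at fronts containing $\emptyset$ (i.e. $\mathcal B=\{\emptyset\}$). Cascade limits: let $X$ be a topological space, $\mathcal B$ a front on $M$, $p$ a free ultrafilter on $\omega$ with $M\in p$, and $f$ a function into $X$ whose domain contains $\mathcal B$. Recursively, $x\in X$ is a $\mathcal B$-cascade $p$-limit point of $f$ if: when $\emptyset\in\mathcal B$, $f(\emptyset)=x$; otherwise, there exist $A\in p$ with $A\subseteq M$ and a family $(x_n:n\in A)$ in $X$ such that for every $n\in A$, $x_n$ is a $\mathcal B_{\{n\}}$-cascade $p$-limit point of $f_n:\mathcal B_{\{n\}}\to X$, $f_n(s)=f(\{n\}\cup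 s)$, where $\mathcal B_{\{n\}}$ is seen as a front on $M\setminus(n+1)$, and $x$ is a $p$-limit of $(x_n:n\in A)$, i.e. $\{n\in A:x_n\in U\}\in p$ for every neighborhood $U$ of $x$. For a front $\mathcal B$ on $M$, $X$ is $\mathcal B$-cascade countably compact if for every $f:\mathcal B\to X$ there is a free ultrafilter $p$ on $\omega$ with $M\in p$ such that $f$ has a $\mathcal B$-cascade $p$-limit point in $X$. A space is countably compact if every sequence $(x_n:n\in\omega)$ in it has an accumulation point, i.e. a point each of whose neighborhoods contains $x_n$ for infinitely many $n$. *)

(* Defs.v *)
From HB Require Import structures.
From mathcomp Require Import all_boot all_order finmap.
From mathcomp Require Import boolp classical_sets functions cardinality filter.
From mathcomp Require Import topology.

Set Implicit Arguments.
Unset Strict Implicit.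
Unset Printing Implicit Defensive.

Local Open Scope classical_set_scope.

HB.mixin Record isTopologicalGroup G & Group G & Topological G := {
  mulg_continuous : continuous (fun xy : G * G => (xy.1 * xy.2)%g) ;
  invg_continuous : continuous (fun x : G => (x^-1)%g)
}.

(* Written multiplicatively; not assumed abelian. *)
#[short(type="topologicalGroupType")]
HB.structure Definition TopologicalGroup :=
  { G of Group G & Topological G & isTopologicalGroup G }.

Definition countably_compact (X : topologicalType) : Prop :=
  forall x_ : nat -> X, exists x : X,
    forall U : set X, nbhs x U -> infinite_set [set n | U (x_ n)].

Definition initial_segment (a b : set nat) : Prop :=
  a `<=` b /\ forall m n, a m -> b n -> (n <= m)%N -> a n.

Definition is_front (M : set nat) (B : set {fset nat}) : Prop :=
  [/\ infinite_set M,
      forall s, B s -> [set` s] `<=` M,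
      forall s t, B s -> B t -> initial_segment [set` s] [set` t] -> s = t &
      forall N : set nat, infinite_set N -> N `<=` M ->
        exists2 s, B s & initial_segment [set` s] N].

(* The family written B_{n} in the literature. *)
Definition front_at (B : set {fset nat}) (n : nat) : set {fset nat} :=
  [set (t `\ n)%fset | t in
    [set t | B t /\ initial_segment [set n] [set` t]]].

Definition free_ultrafilter (p : set_system nat) : Prop :=
  UltraFilter p /\ \bigcap_(A in p) A = set0.

(* [cascade_limit p M B f x]: x is a B-cascade p-limit point of f, where B is
   seen as a front on M. Since passing from a front B to the fronts
   [front_at B n] is a well-founded recursion, the recursive definition is
   rendered as an inductive predicate. Functions on B are represented by total
   functions on {fset nat}, and families indexed by A by total functions on
   nat; only the values on B, resp. on A, are used. *)
Inductive cascade_limit (X : topologicalType) (p : set_system nat) :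
    set nat -> set {fset nat} -> ({fset nat} -> X) -> X -> Prop :=
| cascade_limit_base M B f x :
    B fset0 -> f fset0 = x -> cascade_limit p M B f x
| cascade_limit_step M B f x (A : set nat) (x_ : nat -> X) :
    ~ B fset0 -> p A -> A `<=` M ->
    (forall n, A n ->
      cascade_limit p (M `\` [set k | (k < n.+1)%N]) (front_at B n)
        (fun s => f (n |` s)%fset) (x_ n)) ->
    (forall U : set X, nbhs x U -> p [set n | A n /\ U (x_ n)]) ->
    cascade_limit p M B f x.

Definition cascade_countably_compact (M : set nat) (B : set {fset nat})
    (X : topologicalType) : Prop :=
  forall f : {fset nat} -> X, exists p : set_system nat,
    [/\ free_ultrafilter p, p M & exists x : X, cascade_limit p M B f x].

(* Here m is the minimum of s; its existence forces s to be nonempty. *)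
Definition schreier_barrier : set {fset nat} :=
  [set s | exists m, [/\ m \in s, forall k, k \in s -> (m <= k)%N &
                         #|` s| = m.+1]].

Lemma schreier_barrier_front : is_front setT schreier_barrier.
Proof.
split=> //.
- exact: infinite_nat.
- move=> s t [m [ms mle cs]] [k [kt kle ct]] [st cl].
  have mt : m \in t by apply: st.
  have ks : k \in s by apply: (cl m k) => //; apply: kle.
  have mk : m = k by apply/eqP; rewrite eqn_leq mle // kle.
  apply/eqP; rewrite eqEfcard ct -mk cs leqnn andbT.
  by apply/fsubsetP => x xs; apply: st.
- move=> N Ninf _.
  have least (P : set nat) : P !=set0 ->
      exists2 m, P m & forall k, P k -> (m <= k)%N.
    move=> [x Px]; have ex : exists n, `[< P n >] by exists x; apply/asboolP.
    case: (ex_minnP ex) => m /asboolP Pm mle.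
    by exists m => // k Pk; apply: mle; apply/asboolP.
  have init k : exists2 s : {fset nat},
      #|` s| = k & initial_segment [set` s] N.
    elim: k => [|k [s sk [sN cl]]].
      by exists fset0; [rewrite cardfs0 | split=> // x; rewrite /= inE].
    have /least[m [Nm ms] mle] : (N `\` [set` s]) !=set0.
      apply/set0P/eqP => Ns; apply: Ninf.
      apply: (sub_finite_set (B := [set` s])) => //.
      by rewrite -setD_eq0.
    exists (m |` s)%fset.
      by rewrite cardfsU1; move/negP: ms => /= ->; rewrite sk.
    split=> [x|x y] /=; rewrite in_fset1U => /orP[/eqP->//|xs].
    + exact: sN.
    + move=> Ny yx; rewrite in_fset1U; case: (boolP (y \in s)) => [|ys].
        by rewrite orbT.
      by rewrite orbF eqn_leq yx mle //=; split => //; apply/negP.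
    + by move=> Ny yx; rewrite in_fset1U [y \in s](cl x y) ?orbT.
  have /least[m Nm mle] : N !=set0.
    by apply/set0P/eqP => N0; apply: Ninf; rewrite N0.
  have [s sm [sN cl]] := init m.+1.
  exists s => //; exists m; split=> // [|k ks]; last exact/mle/sN.
  have /fset0Pn[x xs] : s != fset0 by rewrite -cardfs_gt0 sm.
  by apply: (cl x m) => //; exact/mle/sN.
Qed.

(* Main.v *)
Require Import Defs.
From mathcomp Require Import all_boot all_order finmap.
From mathcomp Require Import boolp classical_sets functions cardinality filter.
From mathcomp Require Import topology.

(** Given a sequence [u] in [G^omega], a single cascade limit is made to yield
    one ultrafilter along which every coordinate of [u] converges.  To the set
    [n < m_1 < ... < m_n] of the Schreier barrier assign the product
    [u_{m_1}(0) * u_{m_2}(1) * ... * u_{m_n}(n-1)].  Let [p] be an ultrafilter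
    along which this function has a cascade limit, and fix one of the first
    elements [n] that the cascade allows.  In the innermost limit, over [m_n],
    only the last factor varies; multiplying by the inverse of the other
    factors shows that [u_m(n-1)] converges to some [z_{n-1}] as [m] tends to
    [p].  Since [G] is Hausdorff, [z_{n-1}] is unique, so the next limit, over
    [m_{n-1}], is that of [u_{m_1}(0) * ... * u_{m_{n-1}}(n-2) * z_{n-1}], and
    there [u_m(n-2)] is again the only variable factor.  Going outwards, all
    coordinates below [n] converge along [p]
    ([cascade_limit_subsets_above]).

    The admissible [n] form a set in the free ultrafilter [p], hence are
    unbounded, so every coordinate of [u] converges along [p].  Then [u]
    converges along [p] in the product, and its limit is an accumulation point
    because the members of [p] are infinite. *)

Local Open Scope classical_set_scope.

Lemma cvgMg {G : topologicalGroupType} {T : Type} {F : set_system T}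
    (FF : Filter F) (u v : T -> G) (a b : G) :
  u @ F --> a -> v @ F --> b -> (fun t => (u t * v t)%g) @ F --> (a * b)%g.
Proof.
move=> ua vb.
exact: (cvg_comp _ _ (cvg_pair ua vb) (@mulg_continuous G (a, b))).
Qed.

(** For each [k < N], freeness gives a member of [p] avoiding [k]; intersect
    these finitely many members. *)
Lemma free_ultrafilter_ge (p : set_system nat) (N : nat) :
  free_ultrafilter p -> p [set k | (N <= k)%N].
Proof.
move=> [pU p0]; elim: N => [|N pN].
  by apply: filterS filterT.
have [B pB BN] : exists2 B, p B & ~ B N.
  have : ~ (\bigcap_(A in p) A) N by rewrite p0.
  by move=> /existsNP[B /not_implyP[pB BN]]; exists B.
apply: filterS (filterI pN pB) => k [/= Nk Bk].
by rewrite ltn_neqAle Nk andbT; apply/eqP => Nk'; apply: BN; rewrite Nk'.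
Qed.

(** Being an initial segment of [t], the singleton of [n] consists of the least
    element of [t]; so the sections of a family are read off by adjoining [n]
    to sets that lie above it. *)
Lemma front_atE (B : set {fset nat}) (n : nat) :
  front_at B n =
  [set s | (forall k, k \in s -> (n < k)%N) /\ B (n |` s)%fset].
Proof.
apply/seteqP; split=> [_ [t [Bt [nt cl]] <-]|s [ns Bs]] /=.
  have tn : n \in t by apply: nt.
  rewrite fsetD1K //; split=> // k; rewrite in_fsetD1 => /andP[kn kt].
  rewrite ltnNge; apply/negP => le_kn.
  by move/eqP: kn; apply; apply: (cl n k).
have sn : n \notin s by apply/negP => /ns; rewrite ltnn.
exists (n |` s)%fset; last by rewrite fsetU1K.
split=> //; split=> [_ -> /=|_ k -> /=]; rewrite in_fset1U; first by rewrite eqxx.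
move=> /orP[/eqP//|/ns nk le_kn].
by move: (leq_trans nk le_kn); rewrite ltnn.
Qed.

Definition subsets_above (n r : nat) : set {fset nat} :=
  [set s | #|` s| = r /\ forall k, k \in s -> (n < k)%N].

Lemma front_at_subsets_above (n m r : nat) : (n < m)%N ->
  front_at (subsets_above n r.+1) m = subsets_above m r.
Proof.
move=> nm; rewrite front_atE; apply/seteqP; split=> s /= [].
  move=> ms [+ _]; have /negPf sm : m \notin s by apply/negP => /ms; rewrite ltnn.
  by rewrite cardfsU1 sm => -[].
move=> sr ms; have sm : m \notin s by apply/negP => /ms; rewrite ltnn.
split=> //; split; first by rewrite cardfsU1 sm sr.
move=> k; rewrite in_fset1U => /orP[/eqP->//|/ms]; exact: ltn_trans.
Qed.

Lemma front_at_schreier_barrier (n : nat) :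
  front_at schreier_barrier n = subsets_above n n.
Proof.
rewrite front_atE; apply/seteqP; split=> s /= [].
  move=> ns [m [mns mle]].
  have sn : n \notin s by apply/negP => /ns; rewrite ltnn.
  have -> : m = n.
    apply/eqP; rewrite eqn_leq mle ?in_fset1U ?eqxx //=.
    by move: mns; rewrite in_fset1U => /orP[/eqP->//|/ns/ltnW].
  by rewrite cardfsU1 sn => -[].
move=> sr ns; have sn : n \notin s by apply/negP => /ns; rewrite ltnn.
split=> //; exists n; split; first by rewrite in_fset1U eqxx.
  by move=> k; rewrite in_fset1U => /orP[/eqP->//|/ns/ltnW].
by rewrite cardfsU1 sn sr.
Qed.

Lemma sort_fsetU1 (m : nat) (s : {fset nat}) :
  (forall k, k \in s -> (m < k)%N) ->
  sort leq (m |` s)%fset = m :: sort leq s.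
Proof.
move=> ms; have sm : m \notin s by apply/negP => /ms; rewrite ltnn.
apply: (@sorted_eq _ leq) => //; first exact: leq_trans.
- exact: anti_leq.
- exact: (sort_sorted leq_total).
- rewrite /= path_min_sorted ?(sort_sorted leq_total) //.
  by apply/allP => k; rewrite mem_sort => /ms/ltnW.
- apply: uniq_perm; rewrite /= ?mem_sort ?sort_uniq ?fset_uniq ?sm //.
  by move=> k; rewrite mem_sort !inE mem_sort.
Qed.

(** The two inversion principles read [cascade_limit] as the recursive
    definition that it stands for. *)
Lemma cascade_limit_fset0 {X : topologicalType} {p : set_system nat}
    {M : set nat} {B : set {fset nat}} {f : {fset nat} -> X} {x : X} :
  cascade_limit p M B f x -> B fset0 -> f fset0 = x.
Proof. by case=> // {}M {}B {}f {}x A x_ nB _ _ _ _ /nB. Qed.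

Lemma cascade_limit_stepP {X : topologicalType} {p : set_system nat}
    {M : set nat} {B : set {fset nat}} {f : {fset nat} -> X} {x : X} :
  cascade_limit p M B f x -> ~ B fset0 ->
  exists (A : set nat) (x_ : nat -> X), [/\ p A, A `<=` M,
    forall n, A n -> cascade_limit p (M `\` [set k | (k < n.+1)%N])
      (front_at B n) (fun s => f (n |` s)%fset) (x_ n) &
    forall U : set X, nbhs x U -> p [set n | A n /\ U (x_ n)]].
Proof. by case=> // {}M {}B {}f {}x A x_ _ pA AM clA xA _; exists A, x_. Qed.

(** The factor for the [k]-th entry [m] of [l] is [g (i + k) m]; the offset [i]
    lets the tail of a list be treated as a list. *)
Definition diagonal_prod {G : groupType} (g : nat -> nat -> G) (i : nat)
    (l : seq nat) : G :=
  (\prod_(q <- zip (iota i (size l)) l) g q.1 q.2)%g.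

(** The default value [1] stands for a limit that does not exist. *)
Definition plim {G : topologicalGroupType} (p : set_system nat)
    (u : nat -> G) : G :=
  xget 1%g [set y | u @ p --> y].

Lemma plimP {G : topologicalGroupType} (p : set_system nat) (u : nat -> G)
    (y : G) :
  hausdorff_space G -> ProperFilter p -> u @ p --> y -> plim p u = y.
Proof.
move=> hG pF uy; rewrite /plim; case: xgetP => [z -> uz|/(_ y)//].
exact: (@cvg_unique G hG (u @ p)).
Qed.

(** Each limit of the cascade varies a single factor of the product, the ones to
    its left being fixed by the previous choices (they form the constant [c])
    and the ones to its right having already been replaced by their limits.
    That the value [x] factors through these limits is what makes the
    induction go through: at the next outer stage, the factors on the right are
    the same for all indices, so they cancel. *)
Lemma cascade_limit_subsets_above {G : topologicalGroupType}
    (p : set_system nat) (g : nat -> nat -> G) (r : nat) :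
  hausdorff_space G -> ProperFilter p ->
  forall (n i : nat) (M : set nat) (f : {fset nat} -> G) (c x : G),
    M `<=` [set k | (n < k)%N] ->
    (forall s, subsets_above n r s ->
      f s = (c * diagonal_prod g i (sort leq s))%g) ->
    cascade_limit p M (subsets_above n r) f x ->
  (forall j, (i <= j < i + r)%N -> g j @ p --> plim p (g j)) /\
  x = (c * \prod_(j <- iota i r) plim p (g j))%g.
Proof.
move=> hG pF; elim: r => [|r IH] n i M f c x Mn fE.
  have B0 : subsets_above n 0 fset0 by split; rewrite ?cardfs0.
  move: (fE _ B0) => f0 cl; split.
    by move=> j; rewrite addn0 => /andP[ij /(leq_ltn_trans ij)]; rewrite ltnn.
  rewrite -(cascade_limit_fset0 cl B0).
  rewrite f0 /= big_nil; congr (_ * _)%g.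
  by rewrite /diagonal_prod (_ : sort leq _ = [::]) ?big_nil.
set B := subsets_above n r.+1 => cl.
have nB0 : ~ B fset0 by rewrite /B /= => -[]; rewrite cardfs0.
have [A [x_ [pA AM clA xA]]] := cascade_limit_stepP cl nB0.
have step m : A m ->
    (forall j, (i < j < i + r.+1)%N -> g j @ p --> plim p (g j)) /\
    x_ m = (c * g i m * \prod_(j <- iota i.+1 r) plim p (g j))%g.
  move=> Am; have nm : (n < m)%N by exact/Mn/AM.
  have := clA m Am; rewrite front_at_subsets_above // -addSnnS.
  apply: IH => [k [_ /negP]|s [sr ms]]; first by rewrite /= -leqNgt.
  have [_ Bms] : ((forall k, k \in s -> (m < k)%N) /\ B (m |` s)%fset).
    have : subsets_above m r s by [].
    by rewrite -(front_at_subsets_above n m r nm) front_atE.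
  by rewrite fE // sort_fsetU1 // /diagonal_prod /= big_cons mulgA.
(* The convergence of the later coordinates does not refer to [m], so one
   branch of the cascade gives it. *)
have [m0 Am0] := filter_ex pA.
have [tail _] := step m0 Am0.
have xAx : x_ @ p --> x.
  by move=> U /xA; apply: (@filterS _ p) => m [].
(* On [A], [g i m] is recovered from [x_ m] by cancelling [c] and the limit [P]
   of the factors on the right. *)
set P := (\prod_(j <- iota i.+1 r) plim p (g j))%g.
have gi : g i @ p --> (c^-1 * x * P^-1)%g.
  have lim : (fun m => (c^-1 * x_ m * P^-1)%g) @ p --> (c^-1 * x * P^-1)%g.
    apply: cvgMg; last exact: cvg_cst.
    by apply: cvgMg => //; exact: cvg_cst.
  apply: cvg_trans lim; apply: near_eq_cvg; apply: filterS pA => m Am.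
  by rewrite (step m Am).2 -/P !mulgA mulVg mul1g mulgK.
have zi := plimP p (g i) _ hG pF gi.
split=> [j /andP[]|].
  rewrite leq_eqVlt => /orP[/eqP <- _|ij jr]; first by rewrite zi.
  by apply: tail; rewrite ij.
by rewrite /= big_cons -/P zi !mulgA mulgV mul1g mulgVK.
Qed.

Lemma cvg_ptws (X : topologicalType) (F : set_system nat) (FF : Filter F)
    (u : nat -> {ptws nat -> X}) (y : {ptws nat -> X}) :
  (forall i, (fun k => u k i) @ F --> y i) -> u @ F --> y.
Proof.
move=> uy; apply/cvg_sup => i A; rewrite nbhsE /= => -[B [[C oC <-] Cy] BA].
have : nbhs (y i) C by apply: open_nbhs_nbhs.
by move=> /(uy i); apply: (@filterS _ F) => k Ck; exact: BA.
Qed.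

Theorem corollary5p2 (G : topologicalGroupType) (hG : hausdorff_space G)
    (hB : cascade_countably_compact setT schreier_barrier G) :
  countably_compact {ptws nat -> G}.
Proof.
move=> u; pose g i k := u k i.
have [p [pfree _ [x cl]]] := hB (fun s => diagonal_prod g 0 (behead (sort leq s))).
have pF : ProperFilter p by case: pfree => pU _; exact: ultra_proper.
have nB0 : ~ schreier_barrier fset0 by move=> [m [/=]]; rewrite in_fset0.
have [A [x_ [pA _ clA _]]] := cascade_limit_stepP cl nB0.
(* A set with minimum [n] has [n] further elements, so coordinate [i] occurs in
   its product once [i < n]. *)
have cvg_g i : g i @ p --> plim p (g i).
  have [n [An /= iN]] := filter_ex (filterI pA (free_ultrafilter_ge p i.+1 pfree)).
  move: (clA n An); rewrite front_at_schreier_barrier.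
  move=> /(cascade_limit_subsets_above p g n hG pF n 0 _ _ 1%g)[].
  - by move=> k [_ /negP]; rewrite /= -leqNgt.
  - by move=> s [_ ns]; rewrite sort_fsetU1 // mul1g.
  - by move=> + _; apply; rewrite leq0n.
exists (fun i => plim p (g i)) => U /(cvg_ptws _ _ _ u _ cvg_g) pU.
move=> /finite_seqP[s sE].
have pN := free_ultrafilter_ge p (\max_(k <- s) k).+1 pfree.
have [k [/= Uk sk]] := filter_ex (@filterI _ p _ _ _ pU pN).
have ks : k \in s by move: Uk; rewrite -/([set k | U (u k)] k) sE.
by move: sk; rewrite ltnNge (@leq_bigmax_seq _ s xpredT id).
Qed.
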